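(* Let $n=m\ge1$ and consider a node $J$ with $n$ incoming and $m$ outgoing arcs, with flux $f$, and let $\boldsymbol\theta\in\Theta$. Then the Riemann solver $\mathcal{RS}_2$ satisfies the entropy inequality $\mathcal F(\mathcal{RS}_2(\rho_{1,0},\dots,\rho_{n+m,0}),\sigma)\ge0$ for every initial datum $(\rho_{1,0},\dots,\rho_{n+m,0})\in[0,1]^{n+m}$.
   Context: Flux: $f:[0,1]\to\mathbb R$ is continuous, piecewise smooth, concave, with $f(0)=f(1)=0$, and there is a unique $\sigma\in\,]0,1[$ such that $f$ is strictly increasing on $[0,\sigma[$ and strictly decreasing on $]\sigma,1]$. Convention: $\mathrm{sgn}(0)=0$. Incoming arcs have indices $1,\dots,n$, outgoing arcs $n+1,\dots,n+m$. (E2): a Riemann solver $\mathcal{RS}:[0,1]^{n+m}\to[0,1]^{n+m}$ satisfies (E2) if $\mathcal F(\mathcal{RS}(\rho_{1,0},\dots,\rho_{n+m,0}),\sigma)\ge0$ for every initial datum in $[0,1]^{n+m}$, where $\mathcal F(\rho_1,\dots,\rho_{n+m},k)=\sum_{i=1}^n\mathrm{sgn}(\rho_i-k)(f(\rho_i)-f(k))-\sum_{j=n+1}^{n+m}\mathrm{sgn}(\rho_j-k)(f(\rho_j)-f(k))$. $\Theta$ is the set of $\boldsymbol\theta=(\theta_1,\dots,\theta_{n+m})\in\mathbb R^{n+m}$ with all $\theta_l>0$ and $\sum_{i=1}^n\theta_i=\sum_{j=n+1}^{n+m}\theta_j=1$. Sets of fluxes for an initial datum $(\rho_{1,0},\dots,\rho_{n+m,0})$: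 for $i\le n$, $\Omega_i=[0,f(\rho_{i,0})]$ if $\rho_{i,0}\le\sigma$ and $\Omega_i=[0,f(\sigma)]$ if $\rho_{i,0}\ge\sigma$; for $j\ge n+1$, $\Omega_j=[0,f(\sigma)]$ if $\rho_{j,0}\le\sigma$ and $\Omega_j=[0,f(\rho_{j,0})]$ if $\rho_{j,0}\ge\sigma$. The solver $\mathcal{RS}_2$ (for fixed $\boldsymbol\theta\in\Theta$): let $\Gamma_{inc}=\sum_{i=1}^n\sup\Omega_i$, $\Gamma_{out}=\sum_{j=n+1}^{n+m}\sup\Omega_j$, $\Gamma=\min\{\Gamma_{inc},\Gamma_{out}\}$. Let $I=\{(\gamma_1,\dots,\gamma_n)\in\prod_{i=1}^n\Omega_i:\sum_{i=1}^n\gamma_i=\Gamma\}$ and $\mathcal J=\{(\gamma_{n+1},\dots,\gamma_{n+m})\in\prod_{j=n+1}^{n+m}\Omega_j:\sum_{j=n+1}^{n+m}\gamma_j=\Gamma\}$. Let $(\bar\gamma_1,\dots,\bar\gamma_n)$ be the orthogonal projection of $(\Gamma\theta_1,\dots,\Gamma\theta_n)$ on the closed convex set $I$ and $(\bar\gamma_{n+1},\dots,\bar\gamma_{n+m})$ the orthogonal projection of $(\Gamma\theta_{n+1},\dots,\Gamma\theta_{n+m})$ on the closed convex set $\mathcal J$. For $i\le n$, $\bar\rho_i=\rho_{i,0}$ if $f(\rho_{i,0})=\bar\gamma_i$, otherwise $\bar\rho_i$ is the solution of $f(\rho)=\bar\gamma_i$ with $\rho\ge\sigma$; for $j\ge n+1$,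 $\bar\rho_j=\rho_{j,0}$ if $f(\rho_{j,0})=\bar\gamma_j$, otherwise $\bar\rho_j$ is the solution of $f(\rho)=\bar\gamma_j$ with $\rho\le\sigma$. Then $\mathcal{RS}_2(\rho_{1,0},\dots,\rho_{n+m,0})=(\bar\rho_1,\dots,\bar\rho_{n+m})$. *)

(* Defs.v *)
From HB Require Import structures.
From mathcomp Require Import all_boot all_order all_algebra.
From mathcomp Require Import all_classical all_reals all_analysis.
Import Order.TTheory GRing.Theory Num.Theory.
Import numFieldNormedType.Exports.

Set Implicit Arguments.
Unset Strict Implicit.
Unset Printing Implicit Defensive.

Local Open Scope classical_set_scope.
Local Open Scope ring_scope.

(* A function on [0, 1] is represented by a total function R -> R of which only
   the restriction to [0, 1] matters, a state of the node by a row vector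
   rho : 'rV_(n + m): lsubmx rho holds the n incoming densities and rsubmx rho
   the m outgoing ones. *)

Section Flux.
Context {R : realType}.
Implicit Types (f : R -> R) (sigma : R).

(* The finite set s contains the breakpoints: f is C^1 on each of the open
   subintervals that s cuts out of ]0, 1[. No bound on the derivative is asked
   for at the breakpoints, so that this is implied by every stricter
   convention (C^infinity pieces, one-sided derivatives). *)
Definition piecewise_smooth f : Prop :=
  exists s : seq R, forall x, x \in `]0, 1[ -> x \notin s ->
    derivable f x 1 /\ {for x, continuous (derive1 f)}.

Definition concave_on01 f : Prop :=
  @convex_function R R^o `[0, 1] (fun x => - f x).

Definition flux_peak f sigma : Prop :=
  [/\ sigma \in `]0, 1[,
      {in `[0, sigma[ &, {homo f : x y / x < y}} &
      {in `]sigma, 1] &, {homo f : x y /~ x < y}}].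

Record is_flux f : Prop := IsFlux {
  flux_continuous : {within `[0, 1], continuous f};
  flux_piecewise_smooth : piecewise_smooth f;
  flux_concave : concave_on01 f;
  flux_at0 : f 0 = 0;
  flux_at1 : f 1 = 0;
  flux_unique_peak : exists! sigma, flux_peak f sigma }.

End Flux.

Section Node.
Context {R : realType} {n m : nat}.
Implicit Types (f : R -> R) (sigma : R) (rho theta : 'rV[R]_(n + m)).

Definition unit_box rho : Prop := forall l, rho 0 l \in `[0, 1].

(* Num.sg 0 = 0 *)
Definition entropy_flux f rho (k : R) : R :=
  \sum_(i < n) Num.sg (lsubmx rho 0 i - k) * (f (lsubmx rho 0 i) - f k)
  - \sum_(j < m) Num.sg (rsubmx rho 0 j - k) * (f (rsubmx rho 0 j) - f k).

Definition satisfies_E2 f sigma (RS : 'rV[R]_(n + m) -> 'rV[R]_(n + m)) : Prop :=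
  forall rho0, unit_box rho0 -> 0 <= entropy_flux f (RS rho0) sigma.

Definition Theta : set 'rV[R]_(n + m) :=
  [set theta : 'rV[R]_(n + m) | [/\ forall l, 0 < theta 0 l,
                   \sum_(i < n) lsubmx theta 0 i = 1 &
                   \sum_(j < m) rsubmx theta 0 j = 1]].

End Node.

Section Projection.
Context {R : realType} {k : nat}.
Implicit Types (A : set 'rV[R]_k) (x y p : 'rV[R]_k).

(* The norm `|x| of the library is the sup norm on row vectors, hence this
   explicit Euclidean distance. *)
Definition eucl_dist x y : R := Num.sqrt (\sum_(i < k) (x 0 i - y 0 i) ^+ 2).

Definition is_orth_proj A x p : Prop :=
  A p /\ forall q, A q -> eucl_dist x p <= eucl_dist x q.

(* The default value 0 is used only if there is no projection, which is
   excluded when A is closed, convex and nonempty. *)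
Definition orth_proj A x : 'rV[R]_k := xget 0 (is_orth_proj A x).

Definition flux_slice (Omega : 'I_k -> set R) (Gamma : R) : set 'rV[R]_k :=
  [set g : 'rV[R]_k | (forall i, Omega i (g 0 i)) /\ \sum_(i < k) g 0 i = Gamma].

End Projection.

Section RiemannSolver2.
Context {R : realType}.
Variables (f : R -> R) (sigma : R).

Definition Omega_inc (r : R) : set R :=
  if r <= sigma then `[0, f r]%classic else `[0, f sigma]%classic.

Definition Omega_out (r : R) : set R :=
  if r <= sigma then `[0, f sigma]%classic else `[0, f r]%classic.

(* As in orth_proj, the default value 0 of xget is never used for the fluxes
   that occur: for gamma in [0, f sigma] each equation has exactly one
   solution. *)
Definition density_inc (r gamma : R) : R :=
  if f r == gamma then r
  else xget 0 [set x | x \in `[sigma, 1] /\ f x = gamma].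

Definition density_out (r gamma : R) : R :=
  if f r == gamma then r
  else xget 0 [set x | x \in `[0, sigma] /\ f x = gamma].

Context {n m : nat}.
Implicit Types (theta rho : 'rV[R]_(n + m)).

Definition Gamma_inc rho0 : R := \sum_(i < n) sup (Omega_inc (lsubmx rho0 0 i)).

Definition Gamma_out rho0 : R := \sum_(j < m) sup (Omega_out (rsubmx rho0 0 j)).

Definition Gamma rho0 : R := Num.min (Gamma_inc rho0) (Gamma_out rho0).

Definition slice_inc rho0 : set 'rV[R]_n :=
  flux_slice (fun i => Omega_inc (lsubmx rho0 0 i)) (Gamma rho0).

Definition slice_out rho0 : set 'rV[R]_m :=
  flux_slice (fun j => Omega_out (rsubmx rho0 0 j)) (Gamma rho0).

Definition gamma_inc theta rho0 : 'rV[R]_n :=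
  orth_proj (slice_inc rho0) (Gamma rho0 *: lsubmx theta).

Definition gamma_out theta rho0 : 'rV[R]_m :=
  orth_proj (slice_out rho0) (Gamma rho0 *: rsubmx theta).

Definition RS2 theta rho0 : 'rV[R]_(n + m) :=
  row_mx (\row_i density_inc (lsubmx rho0 0 i) (gamma_inc theta rho0 0 i))
         (\row_j density_out (rsubmx rho0 0 j) (gamma_out theta rho0 0 j)).

End RiemannSolver2.

(* Main.v *)
Require Import Defs.
From mathcomp Require Import all_boot all_order all_algebra.
From mathcomp Require Import all_classical all_reals all_analysis.
From mathcomp Require Import lra.
Import Order.TTheory GRing.Theory Num.Theory.
Import numFieldNormedType.Exports.

Local Open Scope classical_set_scope.
Local Open Scope ring_scope.

Set Implicit Arguments.
Unset Strict Implicit.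

(** Write M for the maximum of the flux f, which is attained at sigma. Every
density produced by the solver satisfies f rho = gamma with 0 <= gamma <= M,
so its term in the entropy flux is M - gamma up to a sign factor in
{-1, 0, 1}, hence at least - (M - gamma).

The sign is the favourable one when gamma is the largest flux that the arc
admits (lemmas [entropy_inc_saturated] and [entropy_out_saturated]): such an
arc either has gamma = M, or keeps its initial density, which then lies on the
side of sigma that makes the term equal to M - gamma.

Since Gamma is the smaller of the two total capacities, all the arcs on one side
of the node are saturated. That side contributes exactly M *+ n - Gamma, the
other one at least - (M *+ m - Gamma), and these balance because n = m.

The vector theta enters only through the point that is projected; all that
matters is that the projection lies in the slice of admissible fluxes with
total Gamma ([orth_proj_in_flux_slice]), which holds because this slice is
compact and nonempty. *)

(** * The flux function *)

(** The monotonicity of f is only known strictly on either side of sigma. A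
maximum point c exists by compactness; were it different from sigma, the
midpoint of c and sigma would lie on the same strictly monotone branch as c
and have a larger value. *)
Lemma flux_max_at_peak (R : realType) (f : R -> R) (sigma : R) :
  is_flux f -> flux_peak f sigma ->
  forall x, x \in `[0, 1] -> f x <= f sigma.
Proof.
move=> hf [+ fincr fdecr]; rewrite in_itv/= => /andP[s0 s1].
have [c + cmax] := EVT_max ler01 (flux_continuous hf).
rewrite in_itv/= => /andP[c0 c1] x x01.
suff -> : sigma = c by exact: cmax.
apply/eqP; apply/negPn/negP => sc.
have [cs|cs|cs] := ltgtP c sigma; last by rewrite cs eqxx in sc.
- have := cmax ((c + sigma) / 2); have := fincr c ((c + sigma) / 2).
  rewrite !in_itv/=; move=> h1 h2.
  have : f c < f ((c + sigma) / 2) by apply: h1; lra.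
  by apply/negP; rewrite -leNgt; apply: h2; lra.
- have := cmax ((c + sigma) / 2); have := fdecr c ((c + sigma) / 2).
  rewrite !in_itv/=; move=> h1 h2.
  have : f c < f ((c + sigma) / 2) by apply: h1; lra.
  by apply/negP; rewrite -leNgt; apply: h2; lra.
Qed.

Lemma flux_ge0 (R : realType) (f : R -> R) (sigma : R) :
  is_flux f -> flux_peak f sigma ->
  forall x, x \in `[0, 1] -> 0 <= f x.
Proof.
move=> hf hs x; have [+ fincr fdecr] := hs.
rewrite !in_itv/= => /andP[s0 s1] /andP[x0 x1].
have [xs|sx|->] := ltgtP x sigma.
- move: x0; rewrite le_eqVlt => /predU1P[<-|x0]; first by rewrite (flux_at0 hf).
  by rewrite -(flux_at0 hf) ltW//; apply: fincr; rewrite ?in_itv/=; lra.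
- move: x1; rewrite le_eqVlt => /predU1P[->|x1]; first by rewrite (flux_at1 hf).
  by rewrite -(flux_at1 hf) ltW//; apply: fdecr; rewrite ?in_itv/=; lra.
- rewrite -(flux_at0 hf); apply: (flux_max_at_peak hf hs).
  by rewrite in_itv/= lexx ler01.
Qed.

(** * Admissible fluxes and densities of a single arc *)

Lemma Omega_inc_segment (R : realType) (f : R -> R) (sigma r : R) :
  is_flux f -> flux_peak f sigma -> r \in `[0, 1] ->
  let c := sup (Omega_inc f sigma r) in
  Omega_inc f sigma r = `[0, c]%classic /\ 0 <= c <= f sigma.
Proof.
move=> hf hs r01; have [/subset_itv_oo_cc s01 _ _] := hs; rewrite /Omega_inc.
by case: ifP => _ /=; rewrite sup_itvcc ?(flux_ge0 hf hs)//; split;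
  rewrite ?(flux_ge0 hf hs) ?(flux_max_at_peak hf hs).
Qed.

Lemma Omega_out_segment (R : realType) (f : R -> R) (sigma r : R) :
  is_flux f -> flux_peak f sigma -> r \in `[0, 1] ->
  let c := sup (Omega_out f sigma r) in
  Omega_out f sigma r = `[0, c]%classic /\ 0 <= c <= f sigma.
Proof.
move=> hf hs r01; have [/subset_itv_oo_cc s01 _ _] := hs; rewrite /Omega_out.
by case: ifP => _ /=; rewrite sup_itvcc ?(flux_ge0 hf hs)//; split;
  rewrite ?(flux_ge0 hf hs) ?(flux_max_at_peak hf hs).
Qed.

(** The intermediate value theorem on [sigma, 1], where f takes the extreme
values M and 0, shows that the default value of [density_inc] is not used. *)
Lemma f_density_inc (R : realType) (f : R -> R) (sigma r gamma : R) :
  is_flux f -> flux_peak f sigma -> 0 <= gamma <= f sigma ->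
  f (density_inc f sigma r gamma) = gamma.
Proof.
move=> hf hs /andP[g0 gM]; rewrite /density_inc; case: eqP => // _.
have [+ _ _] := hs; rewrite in_itv/= => /andP[s0 s1].
have [||x xs1 fx] := @IVT R f sigma 1 gamma (ltW s1).
- apply: continuous_subspaceW (flux_continuous hf).
  by apply: subset_itvr; rewrite bnd_simp ltW.
- by rewrite (flux_at1 hf) ge_min le_max g0 gM orbT.
- by case: xgetP => [y _ []//|/(_ x) []].
Qed.

Lemma f_density_out (R : realType) (f : R -> R) (sigma r gamma : R) :
  is_flux f -> flux_peak f sigma -> 0 <= gamma <= f sigma ->
  f (density_out f sigma r gamma) = gamma.
Proof.
move=> hf hs /andP[g0 gM]; rewrite /density_out; case: eqP => // _.
have [+ _ _] := hs; rewrite in_itv/= => /andP[s0 s1].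
have [||x xs1 fx] := @IVT R f 0 sigma gamma (ltW s0).
- apply: continuous_subspaceW (flux_continuous hf).
  by apply: subset_itvl; rewrite bnd_simp ltW.
- by rewrite (flux_at0 hf) ge_min le_max g0 gM orbT.
- by case: xgetP => [y _ []//|/(_ x) []].
Qed.

(** * Entropy contribution of a single arc *)

Lemma sg_mulr_bound (R : realDomainType) (x d : R) :
  d <= 0 -> d <= Num.sg x * d <= - d.
Proof.
by move=> d0; have [_|_|_] := sgrP x; rewrite ?mul0r ?mul1r ?mulN1r; lra.
Qed.

(** If r <= sigma, the largest flux is f r, so the density r is kept and the
sign is -1, or 0 when r = sigma and both sides vanish. If sigma < r, the
largest flux is M and both sides vanish. *)
Lemma entropy_inc_saturated (R : realType) (f : R -> R) (sigma r : R) :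
  is_flux f -> flux_peak f sigma -> r \in `[0, 1] ->
  let gamma := sup (Omega_inc f sigma r) in
  let rho := density_inc f sigma r gamma in
  f sigma - gamma = Num.sg (rho - sigma) * (f rho - f sigma).
Proof.
move=> hf hs r01 gamma rho.
have [_ cM] := Omega_inc_segment hf hs r01.
have frho : f rho = gamma by exact: f_density_inc.
rewrite frho; move: frho; rewrite /rho /gamma /density_inc /Omega_inc.
have [rs|rs] := leP r sigma; rewrite sup_itvcc ?(flux_ge0 hf hs)//.
- rewrite eqxx => _; move: rs; rewrite le_eqVlt => /predU1P[->|rs].
    by rewrite !subrr mulr0.
  by rewrite ltr0_sg ?subr_lt0// mulN1r opprB.
- by move=> _; rewrite !subrr mulr0.
- by have [/subset_itv_oo_cc] := hs.
Qed.

Lemma entropy_out_saturated (R : realType) (f : R -> R) (sigma r : R) :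
  is_flux f -> flux_peak f sigma -> r \in `[0, 1] ->
  let gamma := sup (Omega_out f sigma r) in
  let rho := density_out f sigma r gamma in
  f sigma - gamma = - (Num.sg (rho - sigma) * (f rho - f sigma)).
Proof.
move=> hf hs r01 gamma rho.
have [_ cM] := Omega_out_segment hf hs r01.
have frho : f rho = gamma by exact: f_density_out.
rewrite frho; move: frho; rewrite /rho /gamma /density_out /Omega_out.
have [rs|rs] := leP r sigma; rewrite sup_itvcc ?(flux_ge0 hf hs)//.
- by move=> _; rewrite !subrr mulr0 oppr0.
- by have [/subset_itv_oo_cc] := hs.
- by rewrite eqxx => _; rewrite gtr0_sg ?subr_gt0// mul1r opprB.
Qed.

(** * Projection onto the slice of admissible fluxes *)

Lemma continuous_eucl_dist (R : realType) (k : nat) (x : 'rV[R]_k) :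
  continuous (eucl_dist x).
Proof.
move=> q; apply: (@continuous_comp _ _ _
  (fun q : 'rV[R]_k => \sum_(i < k) (x 0 i - q 0 i) ^+ 2) Num.sqrt);
  last exact: sqrt_continuous.
apply: continuous_big => [|i _ {}q]; first exact: add_continuous.
apply: (@continuous_comp _ _ _ (fun q : 'rV[R]_k => x 0 i - q 0 i)
    (fun y => y ^+ 2));
  last exact: exprn_continuous.
apply: continuousB; first exact: cst_continuous.
exact: coord_continuous.
Qed.

Lemma orth_projP (R : realType) (k : nat) (A : set 'rV[R]_k) (x : 'rV[R]_k) :
  compact A -> A !=set0 -> is_orth_proj A x (orth_proj A x).
Proof.
move=> cA A0; apply: xgetPex.
have [|p pA pmin] := @EVT_min_rV _ _ (eucl_dist x) _ A0 cA.
  by apply: continuous_subspaceT; exact: continuous_eucl_dist.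
exists p; split; first exact/set_mem.
by move=> q qA; apply/pmin/mem_set.
Qed.

Lemma compact_flux_slice (R : realType) (k : nat) (Omega : 'I_k -> set R)
    (Gamma : R) :
  (forall i, compact (Omega i)) -> compact (flux_slice Omega Gamma).
Proof.
move=> cO.
have -> : flux_slice Omega Gamma =
    [set v : 'rV[R]_k | forall i, Omega i (v 0 i)] `&`
    (fun g : 'rV[R]_k => \sum_(i < k) g 0 i) @^-1` [set Gamma] by [].
apply: compact_closedI; first exact: rV_compact.
apply: preimage_closed; last exact: closed_eq.
move=> q _; apply: continuous_big => [|i _]; first exact: add_continuous.
exact: coord_continuous.
Qed.

(** Scaling all the capacities by the common factor Gamma / \sum_i c i reaches
the total Gamma. If the capacities all vanish then so does Gamma, and the
convention 0^-1 = 0 makes the same witness work. *)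
Lemma flux_slice_nonempty (R : realType) (k : nat) (c : 'I_k -> R) (Gamma : R) :
  (forall i, 0 <= c i) -> 0 <= Gamma <= \sum_(i < k) c i ->
  flux_slice (fun i => `[0, c i]%classic) Gamma !=set0.
Proof.
move=> c0 /andP[G0 Gc].
have S0 : 0 <= \sum_(i < k) c i by exact: sumr_ge0.
exists (\row_i (Gamma / (\sum_(i < k) c i) * c i)); split.
  move=> i; rewrite mxE /= in_itv/= mulr_ge0 ?divr_ge0//=.
  have [->|S0'] := eqVneq (\sum_(i < k) c i) 0.
    by rewrite invr0 mulr0 mul0r.
  by rewrite ler_piMl// ler_pdivrMr ?mul1r// lt_neqAle eq_sym S0'.
under eq_bigr do rewrite mxE; rewrite -mulr_sumr.
have [S|S0'] := eqVneq (\sum_(i < k) c i) 0; last by rewrite divfK.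
by rewrite S mulr0; apply/esym/le_anti; rewrite G0 -S Gc.
Qed.

(** This is the only information about the projected fluxes on which the
entropy estimate relies. *)
Lemma orth_proj_in_flux_slice (R : realType) (k : nat) (Omega : 'I_k -> set R)
    (Gamma : R) (x : 'rV[R]_k) :
  (forall i, Omega i = `[0, sup (Omega i)]%classic /\ 0 <= sup (Omega i)) ->
  0 <= Gamma <= \sum_(i < k) sup (Omega i) ->
  let g := orth_proj (flux_slice Omega Gamma) x in
  (forall i, 0 <= g 0 i <= sup (Omega i)) /\ \sum_(i < k) g 0 i = Gamma.
Proof.
move=> hO hG g.
have [||[gO gs] _] := @orth_projP R k (flux_slice Omega Gamma) x.
- apply: compact_flux_slice => i.
  by rewrite (hO i).1; exact: segment_compact.
- have -> : Omega = fun i => `[0, sup (Omega i)]%classic.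
    by apply/funext => i; exact: (hO i).1.
  by apply: flux_slice_nonempty => // i; exact: (hO i).2.
- split=> // i; have := gO i; rewrite {1}(hO i).1.
  by rewrite /= in_itv.
Qed.

(** * Summation over the arcs of one side of the node *)

Lemma entropy_sum_ge (R : realType) (k : nat) (g t : 'I_k -> R) (M : R) :
  (forall i, - (M - g i) <= t i) ->
  \sum_(i < k) g i - M *+ k <= \sum_(i < k) t i.
Proof.
move=> gt; rewrite -[in M *+ k](card_ord k) -sumr_const -sumrB.
by apply: ler_sum => i _; rewrite -opprB.
Qed.

(** Fluxes bounded by the capacities and with the same total are equal to
them. *)
Lemma entropy_sum_saturated (R : realType) (k : nat) (c g t : 'I_k -> R)
    (M : R) :
  (forall i, g i <= c i) -> \sum_(i < k) g i = \sum_(i < k) c i ->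
  (forall i, g i = c i -> M - g i = t i) ->
  M *+ k - \sum_(i < k) g i = \sum_(i < k) t i.
Proof.
move=> gc sgc gt; rewrite -[in M *+ k](card_ord k) -sumr_const -sumrB.
apply: eq_bigr => i _; apply: gt.
have /eqP : \sum_(i < k) (c i - g i) = 0 by rewrite sumrB sgc subrr.
rewrite psumr_eq0; last by move=> j _; rewrite subr_ge0.
by move=> /allP/(_ i); rewrite mem_index_enum subr_eq0 => /(_ isT)/eqP.
Qed.

Unset Implicit Arguments.
Set Strict Implicit.

Theorem proposition5p3 (R : realType) (n m : nat) (hnm : n = m) (hn : (1 <= n)%N)
    (f : R -> R) (sigma : R) (hf : is_flux f) (hsigma : flux_peak f sigma)
    (theta : 'rV[R]_(n + m)) (htheta : Theta theta) :
  satisfies_E2 f sigma (RS2 f sigma theta).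
Proof.
move=> rho0 rho01.
have in01 i : lsubmx rho0 0 i \in `[0, 1] by rewrite mxE.
have out01 j : rsubmx rho0 0 j \in `[0, 1] by rewrite mxE.
have hinc i := Omega_inc_segment hf hsigma (in01 i).
have hout j := Omega_out_segment hf hsigma (out01 j).
have Ginc0 : 0 <= Gamma_inc f sigma rho0.
  by apply: sumr_ge0 => i _; have [_ /andP[]] := hinc i.
have Gout0 : 0 <= Gamma_out f sigma rho0.
  by apply: sumr_ge0 => j _; have [_ /andP[]] := hout j.
have [ginc sinc] : (forall i, 0 <= gamma_inc f sigma theta rho0 0 i
    <= sup (Omega_inc f sigma (lsubmx rho0 0 i))) /\
    \sum_i gamma_inc f sigma theta rho0 0 i = Gamma f sigma rho0.
  apply: (@orth_proj_in_flux_slice R n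
    (fun i => Omega_inc f sigma (lsubmx rho0 0 i))).
    by move=> i; have [? /andP[]] := hinc i.
  by rewrite le_min Ginc0 Gout0 ge_min lexx.
have [gout sout] : (forall j, 0 <= gamma_out f sigma theta rho0 0 j
    <= sup (Omega_out f sigma (rsubmx rho0 0 j))) /\
    \sum_j gamma_out f sigma theta rho0 0 j = Gamma f sigma rho0.
  apply: (@orth_proj_in_flux_slice R m
    (fun j => Omega_out f sigma (rsubmx rho0 0 j))).
    by move=> j; have [? /andP[]] := hout j.
  by rewrite le_min Ginc0 Gout0 ge_min lexx orbT.
have gincM i : 0 <= gamma_inc f sigma theta rho0 0 i <= f sigma.
  have /andP[-> gc] := ginc i; have [_ /andP[_ cM]] := hinc i.
  exact: le_trans gc cM.
have goutM j : 0 <= gamma_out f sigma theta rho0 0 j <= f sigma.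
  have /andP[-> gc] := gout j; have [_ /andP[_ cM]] := hout j.
  exact: le_trans gc cM.
pose rin i :=
  density_inc f sigma (lsubmx rho0 0 i) (gamma_inc f sigma theta rho0 0 i).
pose rout j :=
  density_out f sigma (rsubmx rho0 0 j) (gamma_out f sigma theta rho0 0 j).
pose tin i := Num.sg (rin i - sigma) * (f (rin i) - f sigma).
pose tout j := - (Num.sg (rout j - sigma) * (f (rout j) - f sigma)).
have -> : entropy_flux f (RS2 f sigma theta rho0) sigma =
    \sum_i tin i + \sum_j tout j.
  rewrite /entropy_flux /RS2 row_mxKl row_mxKr -sumrN.
  by congr (_ + _); apply: eq_bigr => l _; rewrite mxE.
have tin_ge : Gamma f sigma rho0 - f sigma *+ n <= \sum_i tin i.
  rewrite -sinc; apply: entropy_sum_ge => i; rewrite /tin f_density_inc// opprB.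
  have /andP[_ gM] := gincM i.
  by apply: (andP (sg_mulr_bound _ _)).1; rewrite subr_le0.
have tout_ge : Gamma f sigma rho0 - f sigma *+ m <= \sum_j tout j.
  rewrite -sout; apply: entropy_sum_ge => j; rewrite /tout f_density_out// lerN2.
  have /andP[_ gM] := goutM j; rewrite -[leRHS]opprB.
  by apply: (andP (sg_mulr_bound _ _)).2; rewrite subr_le0.
have Mnm : f sigma *+ n = f sigma *+ m by rewrite hnm.
(* The side with the smaller total capacity is saturated. *)
have [Gio|Goi] := leP (Gamma_inc f sigma rho0) (Gamma_out f sigma rho0).
- have GE : Gamma f sigma rho0 = Gamma_inc f sigma rho0 by apply/min_idPl.
  rewrite -(@entropy_sum_saturated R n
    (fun i => sup (Omega_inc f sigma (lsubmx rho0 0 i)))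
    (gamma_inc f sigma theta rho0 0) tin (f sigma)).
  + move: tout_ge; rewrite sinc Mnm; lra.
  + by move=> i; have /andP[] := ginc i.
  + by rewrite sinc GE.
  + by move=> i gE; rewrite /tin /rin gE; exact: entropy_inc_saturated.
- have GE : Gamma f sigma rho0 = Gamma_out f sigma rho0 by apply/min_idPr/ltW.
  rewrite -(@entropy_sum_saturated R m
    (fun j => sup (Omega_out f sigma (rsubmx rho0 0 j)))
    (gamma_out f sigma theta rho0 0) tout (f sigma)).
  + move: tin_ge; rewrite sout Mnm; lra.
  + by move=> j; have /andP[] := gout j.
  + by rewrite sout GE.
  + by move=> j gE; rewrite /tout /rout gE; exact: entropy_out_saturated.
Qed.
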